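(* Let $\mathbf{A}$ be a finite idempotent algebra and $B$ a subuniverse of $\mathbf{A}$. Then $B$ Jónsson absorbs $\mathbf{A}$ if and only if for all $a,c,d\in A$ and all $b_1,b_2\in B$, the digraph $(A,E)$ with edge set $E=\{(u,v)\in A^2 : \exists b\in B,\ (b,u,v)\in R\}$, where $R$ is the subuniverse of $\mathbf{A}^3$ generated by $(b_1,a,a)$, $(b_2,c,c)$, $(d,a,c)$, contains a directed path from $a$ to $c$.
   Context: Jónsson absorption: a subuniverse $B$ of $\mathbf{A}$ Jónsson absorbs $\mathbf{A}$ if there are ternary terms $d_0,\dots,d_n$ of $\mathbf{A}$ such that $d_i(b,a,b')\in B$ for all $i$, all $b,b'\in B$, $a\in A$; $d_i(x,y,y)=d_{i+1}(x,x,y)$ for all $i<n$ and all $x,y\in A$; $d_0(x,y,z)=x$ and $d_n(x,y,z)=z$. An algebra is idempotent if every basic operation $f$ satisfies $f(x,\dots,x)\approx x$. *)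

(* Defs.v *)
From mathcomp Require Import all_boot.
From Stdlib Require Import Relations.

Set Implicit Arguments. Unset Strict Implicit. Unset Printing Implicit Defensive.

Record algebra (I : Type) (ar : I -> nat) := Algebra {
  carrier :> finType;
  op : forall f : I, ('I_(ar f) -> carrier) -> carrier }.

Arguments op {I ar} a f _.

Section UA.
Variables (I : Type) (ar : I -> nat).

Inductive term (X : Type) : Type :=
| Var : X -> term X
| App : forall f : I, ('I_(ar f) -> term X) -> term X.

Fixpoint eval (A : algebra ar) (X : Type) (env : X -> A) (t : term X) : A :=
  match t with
  | Var x => env x
  | App f args => op A f (fun k => eval env (args k))
  end.

Definition top3 (A : algebra ar) (t : term 'I_3) (x y z : A) : A :=
  eval (fun i : 'I_3 => nth x [:: x; y; z] i) t.

Definition idempotent_alg (A : algebra ar) : Prop :=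
  forall (f : I) (x : A), op A f (fun _ => x) = x.

Definition subuniverse (A : algebra ar) (B : {set A}) : Prop :=
  forall (f : I) (args : 'I_(ar f) -> A),
    (forall k, args k \in B) -> op A f args \in B.

Definition power (A : algebra ar) (n : nat) : algebra ar :=
  @Algebra I ar {ffun 'I_n -> A}
    (fun f args => [ffun j => op A f (fun k => args k j)]).

Definition in_Sg (A : algebra ar) (X : {set A}) (x : A) : Prop :=
  forall S : {set A}, subuniverse S -> X \subset S -> x \in S.

Definition triple (A : algebra ar) (x y z : A) : power A 3 :=
  [ffun i : 'I_3 => nth x [:: x; y; z] i].

Definition jonsson_absorbs (A : algebra ar) (B : {set A}) : Prop :=
  exists (n : nat) (d : nat -> term 'I_3),
    (forall i, i <= n -> forall (b b' a : A), b \in B -> b' \in B ->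
        top3 (d i) b a b' \in B) /\
    (forall i, i < n -> forall x y : A, top3 (d i) x y y = top3 (d i.+1) x x y) /\
    (forall x y z : A, top3 (d 0) x y z = x) /\
    (forall x y z : A, top3 (d n) x y z = z).

Definition edgeE (A : algebra ar) (B : {set A}) (b1 b2 a c d : A) (u v : A) : Prop :=
  exists2 b, b \in B &
    in_Sg [set triple b1 a a; triple b2 c c; triple d a c] (triple b u v).

End UA.

(* Main.v *)
(** Call a term [t] absorbing if [t(B,A,B)] lies in [B].  A step from [u] to
    [v] relative to a pair [(x,z)] is given by an absorbing [t] with
    [t(x,x,z) = u] and [t(x,z,z) = v]; Jónsson terms are a path from [x] to
    [z] that is uniform in the pair.
    The term [t(r(x,x,z), r(x,y,z), r(x,z,z))] turns steps relative to
    [(u,v)], where [u = r(x,x,z)] and [v = r(x,z,z)], into steps relative to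
    [(x,z)].  Replacing in this way every step of a path by a path repairs one
    more triple of [B x A x B], so that a single pair of elements of [A] is
    always connected by absorbing terms.
    To treat several pairs at once, connectedness is shown to pass to products
    [C1 x C2].  Among the elements reachable from [x], one whose first
    coordinate [w1] generates together with [z1] a minimal subalgebra can be
    moved along a path of [C1] to an element with first coordinate [z1]: by
    minimality, steps relative to [(w1,z1)] are also steps relative to [(c,z1)]
    for every [c] met on the way, and the changes of the second coordinate
    that are needed between two steps are provided by the paths of [C2]. *)
Require Import Defs.
From mathcomp Require Import all_boot.
From mathcomp Require Import boolp.
From Stdlib Require Import Relations.

Set Implicit Arguments. Unset Strict Implicit. Unset Printing Implicit Defensive.

(** * Ternary terms, homomorphisms and products *)

Section Terms.
Variables (I : Type) (ar : I -> nat).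
Implicit Types (C : algebra ar) (t r : term ar 'I_3).

Fixpoint tsubst (X Y : Type) (s : X -> term ar Y) (t : term ar X) : term ar Y :=
  match t with
  | Var x => s x
  | App f args => App (fun k => tsubst s (args k))
  end.

Lemma eval_tsubst C (X Y : Type) (s : X -> term ar Y) (env : Y -> C)
    (t' : term ar X) :
  eval env (tsubst s t') = eval (fun x => eval env (s x)) t'.
Proof.
elim: t' => //= f args IH.
by congr (op _ _ _); apply/funext => k; apply: IH.
Qed.

Definition var3 (i : 'I_3) : term ar 'I_3 := Var ar i.

Definition comp3 t p q r : term ar 'I_3 :=
  tsubst (fun i : 'I_3 => nth p [:: p; q; r] i) t.

Lemma top3_comp C t p q r (x y z : C) :
  top3 (comp3 t p q r) x y z =
  top3 t (top3 p x y z) (top3 q x y z) (top3 r x y z).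
Proof.
rewrite /top3 /comp3 eval_tsubst; congr (eval _ t).
by apply/funext; case=> [[|[|[|]]]].
Qed.

Definition v0 := var3 (inord 0).
Definition v1 := var3 (inord 1).
Definition v2 := var3 (inord 2).

Lemma top3_v0 C (x y z : C) : top3 v0 x y z = x.
Proof. by rewrite /top3 /= inordK. Qed.

Lemma top3_v1 C (x y z : C) : top3 v1 x y z = y.
Proof. by rewrite /top3 /= inordK. Qed.

Lemma top3_v2 C (x y z : C) : top3 v2 x y z = z.
Proof. by rewrite /top3 /= inordK. Qed.

Definition top3E := (top3_comp, top3_v0, top3_v1, top3_v2).

Definition hom C C' (h : C -> C') : Prop :=
  forall (f : I) (args : 'I_(ar f) -> C),
    h (op C f args) = op C' f (fun k => h (args k)).

Lemma hom_top3 C C' (h : C -> C') t (x y z : C) : hom h ->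
  h (top3 t x y z) = top3 t (h x) (h y) (h z).
Proof.
move=> hh; rewrite /top3; elim: t => [i|f args IH] /=.
  by case: i => [[|[|[|]]]].
by rewrite hh; congr (op _ _ _); apply/funext => k; apply: IH.
Qed.

Lemma top3_id C t (x : C) : idempotent_alg C -> top3 t x x x = x.
Proof.
move=> idC; rewrite /top3; elim: t => [i|f args IH] /=.
  by case: i => [[|[|[|]]]].
by rewrite -[RHS](idC f); congr (op _ _ _); apply/funext => k; apply: IH.
Qed.

Lemma top3_in C (S : {set C}) t (x y z : C) :
  subuniverse S -> x \in S -> y \in S -> z \in S -> top3 t x y z \in S.
Proof.
move=> hS xS yS zS; rewrite /top3; elim: t => [i|f args IH] /=.
  by case: i => [[|[|[|]]]].
exact: hS.
Qed.

(** The values of ternary terms at the generators form a subuniverse. The third generator takes the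
    middle place, so [R] consists of the triples [t(b1,d,b2), t(a,a,c), t(a,c,c)]. *)
Lemma in_Sg3 C (g1 g2 g3 y : C) :
  in_Sg [set g1; g2; g3] y <-> exists t, top3 t g1 g3 g2 = y.
Proof.
split=> [/(_ [set w | `[< exists t, top3 t g1 g3 g2 = w >]])|[t <-] S hS /subsetP gS]; last first.
  by apply: top3_in => //; apply: gS; rewrite !inE eqxx ?orbT.
rewrite !inE => H; apply/asboolP/H => [f args hargs|].
  have {}hargs k : exists t, top3 t g1 g3 g2 = args k.
    by have := hargs k; rewrite inE => /asboolP.
  have [ts tsE] := choice hargs.
  rewrite inE; apply/asboolP; exists (App ts); rewrite /top3 /=.
  by congr (op _ _ _); apply/funext.
apply/subsetP => w; rewrite !inE => /orP[/orP[]|] /eqP ->; apply/asboolP.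
- by exists v0; rewrite top3E.
- by exists v2; rewrite top3E.
- by exists v1; rewrite top3E.
Qed.

Lemma hom_coord C n (j : 'I_n) : hom (fun x : power C n => x j).
Proof. by move=> f args /=; rewrite ffunE. Qed.

Lemma top3_triple C t (x1 x2 x3 y1 y2 y3 z1 z2 z3 : C) :
  top3 t (triple x1 x2 x3) (triple y1 y2 y3) (triple z1 z2 z3) =
  triple (top3 t x1 y1 z1) (top3 t x2 y2 z2) (top3 t x3 y3 z3).
Proof.
apply/ffunP => j; rewrite (hom_top3 _ _ _ _ (@hom_coord C 3 j)) !ffunE.
by case: j => [[|[|[|]]]].
Qed.

Lemma triple_inj C (x1 x2 x3 y1 y2 y3 : C) :
  triple x1 x2 x3 = triple y1 y2 y3 -> [/\ x1 = y1, x2 = y2 & x3 = y3].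
Proof.
move=> /ffunP H; split.
- by have := H (inord 0); rewrite !ffunE inordK.
- by have := H (inord 1); rewrite !ffunE inordK.
- by have := H (inord 2); rewrite !ffunE inordK.
Qed.

Definition prodA C1 C2 : algebra ar :=
  @Algebra I ar (C1 * C2)%type
    (fun f args => (op C1 f (fun k => (args k).1), op C2 f (fun k => (args k).2))).

Definition unitA : algebra ar := @Algebra I ar unit (fun _ _ => tt).

Lemma hom_fst C1 C2 : hom (fst : prodA C1 C2 -> C1).
Proof. by []. Qed.

Lemma hom_snd C1 C2 : hom (snd : prodA C1 C2 -> C2).
Proof. by []. Qed.

Lemma prodA_idem C1 C2 :
  idempotent_alg C1 -> idempotent_alg C2 -> idempotent_alg (prodA C1 C2).
Proof. by move=> id1 id2 f [x1 x2] /=; rewrite id1 id2. Qed.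

(** * Steps and paths relative to a pair *)

Definition step (T : term ar 'I_3 -> Prop) C (x z u v : C) : Prop :=
  exists2 t, T t & top3 t x x z = u /\ top3 t x z z = v.

Definition path_in (T : term ar 'I_3 -> Prop) C (x z : C) :=
  clos_refl_trans C (step T x z).

Definition sandwich t r : term ar 'I_3 :=
  comp3 t (comp3 r v0 v0 v2) r (comp3 r v0 v2 v2).

Lemma top3_sandwich C t r (x y z : C) :
  top3 (sandwich t r) x y z =
  top3 t (top3 r x x z) (top3 r x y z) (top3 r x z z).
Proof. by rewrite !top3E. Qed.

Lemma clos_rt_map (X Y : Type) (f : X -> Y) (P : relation X) (Q : relation Y) u v :
  (forall a b, P a b -> clos_refl_trans Y Q (f a) (f b)) ->
  clos_refl_trans X P u v -> clos_refl_trans Y Q (f u) (f v).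
Proof.
move=> PQ; elim=> [a b /PQ //|a|a b c _ ab _ bc]; first exact: rt_refl.
exact: rt_trans ab bc.
Qed.

Lemma path_jonsson (T : term ar 'I_3 -> Prop) C (x z u : C) :
  T v2 -> path_in T x z u z ->
  exists n (d : nat -> term ar 'I_3),
    [/\ forall i, i <= n -> T (d i), d n = v2, top3 (d 0) x x z = u &
        forall i, i < n -> top3 (d i) x z z = top3 (d i.+1) x x z].
Proof.
move=> T2; move: u; apply: clos_refl_trans_ind_right => [|u v [t Tt [tu tv]] + _].
  by exists 0, (fun=> v2); split=> //; rewrite top3E.
move=> [n [d [Td dn d0 dS]]].
exists n.+1, (fun i => if i is j.+1 then d j else t); split=> //.
- by case.
- by case=> [_|i /dS]; first by rewrite d0 tv.
Qed.

Section Connected.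
Variable T : term ar 'I_3 -> Prop.
Hypothesis T_sandwich : forall t r, T t -> T (sandwich t r).

(* Membership in the relation generated by [(x,x)], [(x,z)] and [(z,z)]. *)
Definition link C (x z : C) := step (fun=> True) x z.

Definition generated C (x z w : C) := exists t, top3 t x x z = w.

Definition connected C := forall x z : C, path_in T x z x z.

Lemma link_step C (x z u v p q : C) :
  link x z u v -> step T u v p q -> step T x z p q.
Proof.
move=> [r _ [ru rv]] [t Tt [tp tq]]; exists (sandwich t r); first exact: T_sandwich.
by rewrite !top3_sandwich !ru !rv.
Qed.

Lemma link_path C (x z u v p q : C) :
  link x z u v -> path_in T u v p q -> path_in T x z p q.
Proof. by move=> l; apply: (@clos_rt_map C C id) => a b /(link_step l); apply: rt_step. Qed.

Lemma generated_trans C (x z v w : C) :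
  generated x z v -> generated v z w -> generated x z w.
Proof.
move=> [r rv] [t tw]; exists (comp3 t (comp3 r v0 v0 v2) (comp3 r v0 v0 v2) v2).
by rewrite !top3E rv.
Qed.

Lemma step_generated C (x z u v : C) : step T x z u v -> generated x z v.
Proof. by move=> [t _ [_ tv]]; exists (comp3 t v0 v2 v2); rewrite !top3E. Qed.

(** Apply [t] to the pairs [(x,z), (x,z), (z,z)]; idempotence fixes the second coordinate. *)
Lemma link_from_generated C (x z w : C) :
  idempotent_alg C -> generated x z w -> link x z w z.
Proof.
move=> idC [t tw]; exists (comp3 t v1 v1 v2) => //.
by rewrite !top3E tw top3_id.
Qed.

Lemma link_to_generated C (x z w : C) :
  idempotent_alg C -> generated x z w -> link x z x w.
Proof.
move=> idC [t tw]; exists (comp3 t v0 v0 v1) => //.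
by rewrite !top3E tw top3_id.
Qed.

(** * Connectedness of products *)

Section Product.
Variables C1 C2 : algebra ar.
Hypotheses (id1 : idempotent_alg C1) (id2 : idempotent_alg C2).
Hypotheses (con1 : connected C1) (con2 : connected C2).
Local Notation C := (prodA C1 C2).

Let idC : idempotent_alg C := prodA_idem id1 id2.

Lemma top3_fst t (x y z : C) : (top3 t x y z).1 = top3 t x.1 y.1 z.1.
Proof. exact: hom_top3 (@hom_fst C1 C2). Qed.

Lemma top3_snd t (x y z : C) : (top3 t x y z).2 = top3 t x.2 y.2 z.2.
Proof. exact: hom_top3 (@hom_snd C1 C2). Qed.

Lemma path_same_fst (u v : C) : u.1 = v.1 -> path_in T u v u v.
Proof.
case: u v => [u1 u2] [v1 w2] /= <-; pose f y : C := (u1, y).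
apply: (@clos_rt_map C2 C f) (con2 u2 w2) => a b [t Tt [ta tb]].
apply: rt_step; exists t => //; split; apply/eqP; rewrite -pair_eqE /=.
- by rewrite top3_fst top3_snd /= top3_id // ta !eqxx.
- by rewrite top3_fst top3_snd /= top3_id // tb !eqxx.
Qed.

Section Reach.
Variables x z : C.

(** The first conjunct lets steps relative to [(w,z)] count as steps relative to [(x,z)]. *)
Definition reach (w : C) := generated x z w /\ path_in T x z x w.

Lemma reach_trans (w p : C) : reach w -> path_in T w z w p -> generated w z p -> reach p.
Proof.
move=> [gw xw] wp gp; split; first exact: generated_trans gw gp.
apply: rt_trans xw _; apply: link_path wp; exact: link_from_generated.
Qed.

Lemma reach_same_fst (w p : C) : reach w -> generated w z p -> w.1 = p.1 -> reach p.
Proof.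
move=> rw gp e; apply: (reach_trans rw _ gp).
by apply: link_path (path_same_fst e); exact: (link_to_generated idC gp).
Qed.

Lemma reach_step (w : C) (c : C1) :
  reach w -> step T w.1 z.1 w.1 c -> exists2 w', reach w' & w'.1 = c.
Proof.
move=> rw [t Tt [tw tc]]; exists (top3 t w z z); last by rewrite top3_fst.
have s : step T w z (top3 t w w z) (top3 t w z z) by exists t.
(* [t(w,w,z)] differs from [w] at most in the second coordinate, which a path of [C2] corrects. *)
have [gp xp] : reach (top3 t w w z).
  by apply: reach_same_fst rw _ _; [exists t | rewrite top3_fst].
have [gw _] := rw.
split; first exact: generated_trans gw (step_generated s).
apply: rt_trans xp _; apply: rt_step; apply: link_step s; exact: link_from_generated.
Qed.

Lemma reach_fst (w : C) : reach w -> exists2 w', reach w' & w'.1 = z.1.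
Proof.
(* [S] bounds the subalgebra generated by [w.1] and [z.1]; the induction is on its size. *)
have: exists S : {set C1}, forall c, generated w.1 z.1 c -> c \in S.
  by exists setT => c _; rewrite inE.
case=> S; have [n] := ubnP #|S|; elim: n S w => // n IH S w leSn wS rw.
suff claim c : path_in T w.1 z.1 c z.1 -> generated w.1 z.1 c ->
    (exists2 w', reach w' & w'.1 = c) -> exists2 w', reach w' & w'.1 = z.1.
  by apply: claim (con1 _ _) _ _; [exists v0; rewrite top3E | exists w].
move: c; apply: clos_refl_trans_ind_right => [//|].
move=> c c' s IHs _ gc [w' rw' ew'].
(* If [w.1] is lost, the subalgebra has shrunk and the argument restarts from [w']. *)
have [gw|ngw] := EM (generated c z.1 w.1); last first.
  apply: (IH (S :\ w.1)) rw'.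
    by move: leSn; rewrite (cardsD1 w.1) wS //; exists v0; rewrite top3E.
  move=> e; rewrite ew' !inE => ge; apply/andP; split; last first.
    exact/wS/(generated_trans gc ge).
  by apply/eqP => ee; apply: ngw; rewrite -ee.
apply: (IHs (step_generated s)); apply: (reach_step rw').
by rewrite ew'; apply: link_step s; apply: link_from_generated.
Qed.

End Reach.

Lemma connected_prod : connected C.
Proof.
move=> x z; have rx : reach x z x.
  by split; [exists v0; rewrite top3E | apply: rt_refl].
have [w [gw xw] ew] := reach_fst rx.
apply: rt_trans xw _; apply: link_path (path_same_fst ew).
exact: link_from_generated.
Qed.

End Product.

(* [C] is a finite power of [A]; the coordinates of [(x, z)] run through [L]. *)
Lemma connected_power (A : algebra ar) (L : seq (A * A)) :
  T v0 -> idempotent_alg A -> connected A ->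
  exists (C : algebra ar) (x z : C), path_in T x z x z /\
    forall p, p \in L -> exists2 h : C -> A, hom h & h x = p.1 /\ h z = p.2.
Proof.
move=> T0 idA conA.
suff [C [idC conC [x [z hL]]]] : exists C : algebra ar,
    [/\ idempotent_alg C, connected C & exists x z : C,
      forall p, p \in L -> exists2 h : C -> A, hom h & h x = p.1 /\ h z = p.2].
  by exists C, x, z; split=> //; apply: conC.
elim: L => [|[a c] L [C [idC conC [x [z hL]]]]].
  exists unitA; split; [by move=> f [] | by move=> [] []; apply: rt_refl |].
  by exists tt, tt.
exists (prodA A C); split; [exact: prodA_idem | exact: connected_prod |].
exists (a, x), (c, z) => p; rewrite inE => /orP[/eqP -> | /hL[h hh [hx hz]]].
  by exists fst.
by exists (h \o snd) => // f args /=; rewrite hh.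
Qed.

End Connected.

(** * From local paths to Jónsson terms *)

Section Absorption.
Variables (A : algebra ar) (B : {set A}).
Hypothesis hB : subuniverse B.

(** [S] holds the triples treated so far. *)
Definition absorbing (S : A * A * A -> Prop) t := forall b d b' : A,
  b \in B -> b' \in B -> S (b, d, b') -> top3 t b d b' \in B.

Lemma absorbing_sandwich t r :
  absorbing (fun=> True) t -> absorbing (fun=> True) (sandwich t r).
Proof.
by move=> tB b d b' bB b'B _; rewrite top3_sandwich; apply: tB => //; apply: top3_in.
Qed.

Lemma edgeE_term (b1 b2 a c d u v : A) :
  edgeE B b1 b2 a c d u v <->
  exists2 t, top3 t b1 d b2 \in B & top3 t a a c = u /\ top3 t a c c = v.
Proof.
split=> [[b bB /in_Sg3[t]]|[t tB [tu tv]]].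
  by rewrite top3_triple => /triple_inj[eb eu ev]; exists t; rewrite ?eb.
exists (top3 t b1 d b2) => //; apply/in_Sg3; exists t.
by rewrite top3_triple tu tv.
Qed.

Hypothesis local_path : forall a c d b1 b2 : A, b1 \in B -> b2 \in B ->
  clos_refl_trans A (edgeE B b1 b2 a c d) a c.

Lemma connected_absorbing_seq (L : seq (A * A * A)) :
  connected (absorbing (fun q => q \in L)) A.
Proof.
elim: L => [|[[b1 d] b2] L IH] x z.
  (* With no triple to respect, the middle projection steps from [x] to [z] at once. *)
  by apply: rt_step; exists v1 => //; rewrite !top3E.
apply: (@clos_rt_map A A id) (IH x z) => u v [t tL [tu tv]].
have [/andP[b1B b2B]|nB] := boolP ((b1 \in B) && (b2 \in B)); last first.
  apply: rt_step; exists t => // e f e' eB e'B; rewrite inE.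
  by case/orP=> [/eqP[E1 _ E2]|/tL]; [rewrite -E1 -E2 eB e'B in nB | apply].
have b1tB : top3 t b1 b1 b2 \in B by apply: top3_in.
have b2tB : top3 t b1 b2 b2 \in B by apply: top3_in.
(* The local path is taken at the values of [t], so that [sandwich s t] maps [(b1,d,b2)] into
   [B]. *)
apply: (@clos_rt_map A A id) (local_path u v (top3 t b1 d b2) b1tB b2tB) => p q.
move=> /edgeE_term[s sB [sp sq]]; apply: rt_step; exists (sandwich s t).
  move=> e f e' eB e'B; rewrite inE top3_sandwich => /orP[/eqP[-> -> ->] //|efL].
  by apply: top3_in => //; [apply: top3_in | apply: tL | apply: top3_in].
by rewrite !top3_sandwich tu tv.
Qed.

Lemma connected_absorbing : connected (absorbing (fun=> True)) A.
Proof.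
move=> x z; apply: (@clos_rt_map A A id) (connected_absorbing_seq (enum {: A * A * A}) x z).
move=> u v [t tB tuv]; apply: rt_step; exists t => // b d b' bB b'B _.
by apply: tB => //; rewrite mem_enum.
Qed.

Lemma jonsson_of_local : idempotent_alg A -> jonsson_absorbs B.
Proof.
move=> idA.
have T0 : absorbing (fun=> True) v0 by move=> b d b' bB _ _; rewrite top3E.
have T2 : absorbing (fun=> True) v2 by move=> b d b' _ b'B _; rewrite top3E.
have [C [x [z [xz hC]]]] := connected_power absorbing_sandwich (enum {: A * A})
  T0 idA connected_absorbing.
have [n [d [Td dn d0 dS]]] := path_jonsson T2 xz.
(* The projection [v0] is prepended, since [d 0] is only known to satisfy [d 0 (x,x,z) = x]. *)
exists n.+1, (fun i => if i is j.+1 then d j else v0); split; [|split; [|split]].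
- by case=> [|i] le_in b b' a bB b'B; [apply: T0 | apply: Td].
- move=> i ltin a c; have [|h hh /= [<- <-]] := hC (a, c); first by rewrite mem_enum.
  rewrite -!hom_top3 //; congr (h _).
  by case: i ltin => [_|i /dS //]; rewrite d0 top3E.
- by move=> *; rewrite top3E.
- by move=> *; rewrite dn top3E.
Qed.

End Absorption.

(** * From Jónsson terms to local paths *)

Lemma local_of_jonsson (A : algebra ar) (B : {set A}) (a c d b1 b2 : A) :
  jonsson_absorbs B -> b1 \in B -> b2 \in B ->
  clos_refl_trans A (edgeE B b1 b2 a c d) a c.
Proof.
move=> [n [D [DB [DS [D0 Dn]]]]] b1B b2B.
(* The path runs through the elements [D i (a,a,c)]; the edge leaving the [i]-th is witnessed by
   [D i (b1,d,b2)]. *)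
rewrite -[X in clos_refl_trans _ _ _ X](Dn a a c).
elim: n DB DS {Dn} => [|n IH] DB DS; first by rewrite D0; apply: rt_refl.
apply: rt_trans (IH _ _) _ => [i lin|i lin|]; [by apply/DB/ltnW | by apply/DS/ltnW |].
apply: rt_step; apply/edgeE_term; exists (D n); last by rewrite DS.
by apply: DB.
Qed.

End Terms.

Theorem theorem4p1 (I : Type) (ar : I -> nat) (A : algebra ar)
    (hA : idempotent_alg A) (B : {set A}) (hB : subuniverse B) :
  jonsson_absorbs B <->
  (forall (a c d b1 b2 : A), b1 \in B -> b2 \in B ->
     clos_refl_trans A (edgeE B b1 b2 a c d) a c).
Proof.
split=> [hJ a c d b1 b2 b1B b2B|hloc]; first exact: local_of_jonsson.
exact: jonsson_of_local.
Qed.
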